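(* For $A\in\mathbb{Z}$ let $\mathcal{F}_{3,A,A}(x)=x^{8}+Ax^{6}+Ax^{4}+Ax^{2}+1$. There exist infinitely many integers $A\equiv 1\pmod 4$ such that the Galois group of $\mathcal{F}_{3,A,A}(x)$ over $\mathbb{Q}$ is isomorphic to the wreath product $C_2^2\wr C_2$.
   Context: $C_2$ is the cyclic group of order $2$; $C_2^2\wr C_2=(C_2^2\times C_2^2)\rtimes C_2$ is the wreath product (of order $32$), with $C_2$ permuting the two factors. *)

(* Defs.v *)
From HB Require Import structures.
From mathcomp Require Import all_boot all_order all_algebra all_fingroup.
From mathcomp Require Import all_field.

Set Implicit Arguments.
Unset Strict Implicit.
Unset Printing Implicit Defensive.

Import GRing.Theory.
Local Open Scope ring_scope.

Definition calF3 (A B : int) : {poly int} :=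
  'X^8 + A *: 'X^6 + B *: 'X^4 + A *: 'X^2 + 1.

(* A splitting field of p over rat is unique up to isomorphism, so it does not
   matter which one is taken; asserting its existence rules out vacuity. *)
Definition galois_group_isog (p : {poly rat}) (gT : finGroupType) : Prop :=
  exists2 L : splittingFieldType rat,
    splittingFieldFor 1%VS (map_poly (in_alg L) p) {:L}%VS
    & ('Gal({:L} / 1) \isog [set: gT])%g.

Section WreathC2.

Local Open Scope group_scope.

Variable gT : finGroupType.

(* The group operation of 'Z_2, as a finGroupType, is addition, so its
   identity is 0. *)
Definition swap_fun (x : gT * gT) (a : 'Z_2) : gT * gT :=
  if a == 1 then x else (x.2, x.1).

Lemma swap_is_action : is_action [set: 'Z_2] swap_fun.
Proof.
split=> [a [x1 x2] [y1 y2] | [x1 x2] a b _ _]; rewrite /swap_fun.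
  by case: (a == 1) => [|[-> ->]].
by case: a b => [[|[|//]] ?] [[|[|//]] ?].
Qed.

Definition swap_action := Action swap_is_action.

Lemma swap_is_groupAction : is_groupAction [set: gT * gT] swap_action.
Proof.
move=> a _; rewrite inE; apply/andP; split.
  by apply/subsetP=> x _; rewrite inE.
apply/morphicP=> [[x1 x2] [y1 y2] _ _]; rewrite !actpermE /= /swap_fun.
by case: (a == 1).
Qed.

Definition swap_groupAction := GroupAction swap_is_groupAction.

Definition wreathC2 : finGroupType := sdprod_by swap_groupAction.

End WreathC2.

(* Main.v *)
(* Write w_i^2 = z_i + 2 and v_i^2 = z_i - 2 where z_0, z_1 are the roots of
   z^2 + A z + A - 2, that is, z = x^2 + x^-2 for a root x of the octic.  As
   x + x^-1 and x - x^-1 square to z + 2 and z - 2, the roots of the octic are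
   the (+-w_i +- v_i) / 2, and the splitting field is Q(w_0, w_1, v_0, v_1).
   The way an automorphism permutes {z_0, z_1} and the signs by which it acts
   on the w_i and v_i embed the Galois group into the wreath product.  The image
   is everything as soon as it is not contained in a maximal subgroup, i.e. as
   soon as (z_0 - z_1)^2 = (A - 2)^2 + 4, (w_0 w_1)^2 = 2 - A and
   (v_0 v_1)^2 = 3 A + 2 are independent modulo rational squares.  For
   A = 12 n + 5 each of the seven products is negative, or 5 modulo 8, or 2
   modulo 3. *)

From HB Require Import structures.
Require Import Defs.
From mathcomp Require Import all_boot all_order all_algebra all_fingroup.
From mathcomp Require Import all_field.
From mathcomp Require Import zify ring.

Set Implicit Arguments.
Unset Strict Implicit.
Unset Printing Implicit Defensive.

Import GRing.Theory Num.Theory.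
Local Open Scope ring_scope.

(** * Integer obstructions to being a rational square *)

(** The denominator divides [c * denq r ^+ 2 = numq r ^+ 2] and is coprime to it, so it is 1. *)
Lemma rat_sqr_int (r : rat) (c : int) :
  r ^+ 2 = c%:~R -> exists m : int, m ^+ 2 = c.
Proof.
move=> rc; exists (numq r).
have eq_nd : numq r ^+ 2 = c * denq r ^+ 2.
  apply: (@intr_inj rat); rewrite [in RHS]intrM !rmorphXn /= -rc numqE; ring.
have co_nd : coprimez (denq r) (numq r ^+ 2).
  apply: coprimezXr; rewrite coprimez_sym /coprimez /gcdz.
  exact/eqP/congr1/eqP/coprime_num_den.
have d1 : (denq r %| 1)%Z.
  by rewrite -(Gauss_dvdzr _ co_nd) mulr1 eq_nd expr2 mulrA dvdz_mull.
have d_eq1 : denq r = 1 by have := denq_gt0 r; move: d1; rewrite dvdz1; lia.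
by rewrite eq_nd d_eq1 expr1n mulr1.
Qed.

Lemma sqr_mod3 (m k : int) : m ^+ 2 <> k * 3 + 2.
Proof.
have := divz_eq m 3; have := ltz_pmod m (isT : 0 < 3 :> int).
have := modz_ge0 m (isT : 3 != 0 :> int).
move: (m %/ 3)%Z (m %% 3)%Z => q r r_ge0 r_lt3 ->.
have : r = 0 \/ r = 1 \/ r = 2 by lia.
by case=> [|[]] ->; lia.
Qed.

Lemma sqr_mod8 (m k : int) : m ^+ 2 <> k * 8 + 5.
Proof.
(* Residues modulo 4 suffice: [(4 q + r)^2] is congruent to [r^2] modulo 8. *)
have := divz_eq m 4; have := ltz_pmod m (isT : 0 < 4 :> int).
have := modz_ge0 m (isT : 4 != 0 :> int).
move: (m %/ 4)%Z (m %% 4)%Z => q r r_ge0 r_lt4 ->.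
have : r = 0 \/ r = 1 \/ r = 2 \/ r = 3 by lia.
by case=> [|[|[]]] ->; lia.
Qed.

(** Every product containing [2 - A] is negative. Of the other three, [(A - 2)^2 + 4] alone is 5
    modulo 8 and the two containing [3 A + 2] are 2 modulo 3; the explicit polynomials in [n] are
    the quotients. *)
Lemma nonsquare_products (n : nat) (a b c : bool) (r : rat)
    (A := (12 * n + 5)%N%:Z) :
    a || b || c ->
  r ^+ 2 != (((A - 2) ^+ 2 + 4) ^+ a * (2 - A) ^+ b * (3 * A + 2) ^+ c)%:~R.
Proof.
move=> abc; apply/eqP => rE; have [m] := rat_sqr_int rE.
have : 0 <= m ^+ 2 by exact: sqr_ge0.
case: a b c abc {rE} => [] [] [] // _; rewrite ?expr0 ?expr1 ?mul1r ?mulr1 /A.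
- by nia.
- by nia.
- move=> _ mE.
  apply: (@sqr_mod3 m
    (n%:Z ^+ 3 * 1728 + n%:Z ^+ 2 * 1680 + n%:Z * 564 + 73)).
  by rewrite mE; lia.
- move=> _ mE; apply: (@sqr_mod8 m (n%:Z ^+ 2 * 18 + n%:Z * 9 + 1)).
  by rewrite mE; lia.
- by nia.
- by lia.
- by move=> _ mE; apply: (@sqr_mod3 m (n%:Z * 12 + 5)); rewrite mE; lia.
Qed.

(** * The wreath product in Boolean coordinates, with a generation criterion *)

(* [(a, ((p0, q0), (p1, q1)))]: a swap bit, then the two factors. *)
Definition wreath_bits : Type := bool * ((bool * bool) * (bool * bool)).

(** Semidirect product law for a right action: the swap bit of [t] acts on the base part of [s]
    before the base parts are added. *)
Definition bits_mul (s t : wreath_bits) : wreath_bits :=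
  let: (a, (x0, x1)) := s in let: (b, ((p0, q0), (p1, q1))) := t in
  let: ((p0', q0'), (p1', q1')) := if b then (x1, x0) else (x0, x1) in
  (a (+) b, ((p0' (+) p0, q0' (+) q0), (p1' (+) p1, q1' (+) q1))).

Definition chi_top (s : wreath_bits) : bool := s.1.
Definition chi_fst (s : wreath_bits) : bool := s.2.1.1 (+) s.2.2.1.
Definition chi_snd (s : wreath_bits) : bool := s.2.1.2 (+) s.2.2.2.

Definition bits_char (f : wreath_bits -> bool) : Prop :=
  {morph f : s t / bits_mul s t >-> s (+) t}.

Lemma chi_topM : bits_char chi_top.
Proof. by move=> [a [[p q] [p' q']]] [[] [[t u] [t' u']]]. Qed.

Lemma chi_fstM : bits_char chi_fst.
Proof.
move=> [a [[p q] [p' q']]] [[] [[t u] [t' u']]]; rewrite /chi_fst /=.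
  by case: p p' t t' => [] [] [] [].
by case: p p' t t' => [] [] [] [].
Qed.

Lemma chi_sndM : bits_char chi_snd.
Proof.
move=> [a [[p q] [p' q']]] [[] [[t u] [t' u']]]; rewrite /chi_snd /=.
  by case: q q' u u' => [] [] [] [].
by case: q q' u u' => [] [] [] [].
Qed.

Lemma bits_charD f h :
  bits_char f -> bits_char h -> bits_char (fun s => f s (+) h s).
Proof. by move=> fM hM s t; rewrite fM hM addbACA. Qed.

(** With [s] and [t] the two given witnesses, one of [s], [t] and their product always works. *)
Lemma separate_chars (S : wreath_bits -> Prop) f h :
    (forall s t, S s -> S t -> S (bits_mul s t)) ->
    bits_char f -> bits_char h ->
    (exists2 s, S s & f s) -> (exists2 s, S s & f s (+) h s) ->
  exists2 s, S s & f s && ~~ h s.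
Proof.
move=> SM fM hM [s Ss fs] [t St ft].
have [hs|hs] := boolP (h s); last by exists s; rewrite ?fs.
have [fT|fT] := boolP (f t).
  by exists t => //; rewrite fT; move: ft; rewrite fT.
exists (bits_mul s t); first exact: SM.
by rewrite fM hM fs hs (negbTE fT); move: ft; rewrite (negbTE fT) /= => ->.
Qed.

(* The three characters cut out the Frattini subgroup of the wreath product,
   so a subset closed under multiplication on which they are independent
   generates everything. *)
Lemma bits_full (S : wreath_bits -> Prop) :
    (forall s t, S s -> S t -> S (bits_mul s t)) ->
    (forall a b c : bool, a || b || c -> exists2 s, S s &
       (a && chi_top s) (+) (b && chi_fst s) (+) (c && chi_snd s)) ->
  forall s, S s.
Proof.
move=> SM Schi.
pose N s := S s /\ ~~ chi_top s.
have NM s t : N s -> N t -> N (bits_mul s t).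
  case=> Ss s0 [St t0]; split; first exact: SM.
  by rewrite chi_topM (negbTE s0) (negbTE t0).
(* Independence from [chi_top] lets each nonzero combination of [chi_fst] and [chi_snd] survive on
   its kernel [N]. *)
have Nchi b c : b || c -> exists2 s, N s & (b && chi_fst s) (+) (c && chi_snd s).
  move=> bc.
  have [||||s Ss /andP[fs ts]] := @separate_chars S
      (fun s => (b && chi_fst s) (+) (c && chi_snd s)) chi_top SM; last by exists s.
  - by apply: bits_charD => s t; rewrite ?chi_fstM ?chi_sndM;
      case: b c {bc} => [] [].
  - exact: chi_topM.
  - by have [s Ss fs] := Schi false b c bc; exists s.
  - have [s Ss fs] := Schi true b c isT; exists s => //.
    by rewrite addbC addbA.
have [n1 [Sn1 n1top] /andP[n1fst n1snd]] :
    exists2 s, N s & chi_fst s && ~~ chi_snd s.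
  apply: separate_chars NM chi_fstM chi_sndM _ _.
    by have [s Ns] := Nchi true false isT; rewrite /= addbF; exists s.
  by have [s Ns] := Nchi true true isT; exists s.
have [n2 [Sn2 n2top] /andP[n2snd n2fst]] :
    exists2 s, N s & chi_snd s && ~~ chi_fst s.
  apply: separate_chars NM chi_sndM chi_fstM _ _.
    by have [s Ns] := Nchi false true isT; exists s.
  by have [s Ns] := Nchi true true isT; rewrite addbC; exists s.
have [g Sg gtop] : exists2 s, S s & chi_top s.
  by have [s Ss] := Schi true false false isT; rewrite /= !addbF; exists s.
(* [g ^ 3] is the inverse of [g], so this is [n * n ^ g]. *)
pose tr n := bits_mul n (bits_mul g (bits_mul g (bits_mul g (bits_mul n g)))).
have Str n : S n -> S (tr n) by move=> Sn; do !apply/SM => //.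
(* The base is abelian and [g] exchanges its factors, so [tr n] has both components equal to
   [(chi_fst n, chi_snd n)]. *)
have Sdiag1 : S (false, ((true, false), (true, false))).
  have := Str _ Sn1; congr S; move: gtop n1top n1fst n1snd; rewrite /tr.
  by case: g n1 {Sg Sn1 tr Str} => [[] [[[] []] [[] []]]] [[] [[[] []] [[] []]]].
have Sdiag2 : S (false, ((false, true), (false, true))).
  have := Str _ Sn2; congr S; move: gtop n2top n2fst n2snd; rewrite /tr.
  by case: g n2 {Sg Sn2 tr Str} => [[] [[[] []] [[] []]]] [[] [[[] []] [[] []]]].
have S1 : S (false, ((false, false), (false, false))) := SM _ _ Sdiag1 Sdiag1.
have Sdiag p q : S (false, ((p, q), (p, q))).
  by case: p q => [] [] //; have := SM _ _ Sdiag1 Sdiag2.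
(* A product [t] of some of [n1], [n2] has the same component sum as [x], hence differs from [x] by
   a diagonal element. *)
have S0 x : S (false, x).
  case: x => [[p0 q0] [p1 q1]].
  have [t St [ttop tfst tsnd]] : exists2 t, S t &
      [/\ chi_top t = false, chi_fst t = p0 (+) p1 & chi_snd t = q0 (+) q1].
    pose e : wreath_bits := (false, ((false, false), (false, false))).
    exists (bits_mul (if p0 (+) p1 then n1 else e) (if q0 (+) q1 then n2 else e)).
      by apply: SM; case: ifP.
    rewrite chi_topM chi_fstM chi_sndM.
    case: ifP => _; case: ifP => _; rewrite ?(negbTE n1top) ?(negbTE n2top);
      by rewrite ?n1fst ?n2snd ?(negbTE n1snd) ?(negbTE n2fst).
  have := SM _ _ St (Sdiag (t.2.1.1 (+) p0) (t.2.1.2 (+) q0)); congr S.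
  move: ttop tfst tsnd; case: t {St} => [[] [[[] []] [[] []]]] //;
  by case: p0 p1 q0 q1 => [] [] [] [].
case=> [[] x]; last exact: S0.
have := SM _ _ Sg (S0 (let: ((p0, q0), (p1, q1)) := x in
  let: ((p0', q0'), (p1', q1')) := g.2 in
  ((p0' (+) p0, q0' (+) q0), (p1' (+) p1, q1' (+) q1)))); congr S.
case: g x gtop {Sg tr Str} => [[] [[[] []] [[] []]]] [[p0 q0] [p1 q1]] //= _;
by case: p0 q0 p1 q1 => [] [] [] [].
Qed.

(** * Identification of the Boolean model with [wreathC2] *)

Section WreathEncoding.

Local Open Scope group_scope.

Notation V4 := ('Z_2 * 'Z_2)%type.
Notation W := (wreathC2 V4).

Definition bit2Z (b : bool) : 'Z_2 := (b%:R)%R.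

Lemma bit2ZM a b : bit2Z (a (+) b) = bit2Z a * bit2Z b.
Proof. by case: a b => [] []; apply/eqP. Qed.

(** Here [1] is the group identity, that is, the residue 0. *)
Lemma bit2Z_eq1 b : (bit2Z b == 1) = ~~ b.
Proof. by case: b. Qed.

Lemma bit2Z_inj : injective bit2Z.
Proof. by case=> [] [] // /eqP. Qed.

Lemma bit2Z_surj x : {b | x = bit2Z b}.
Proof. by exists (x != 1); case: x => [[|[|//]]] lt; apply/eqP. Qed.

Definition bits2pair (s : wreath_bits) : 'Z_2 * (V4 * V4) :=
  (bit2Z s.1, ((bit2Z s.2.1.1, bit2Z s.2.1.2), (bit2Z s.2.2.1, bit2Z s.2.2.2))).

Lemma bits2pair_in s :
  bits2pair s \in setX [set: 'Z_2] [set: V4 * V4].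
Proof. by rewrite !inE. Qed.

Definition bits2W (s : wreath_bits) : W :=
  SdPair (swap_groupAction V4) (bits2pair_in s).

Lemma bits2WM : {morph bits2W : s t / bits_mul s t >-> s * t}.
Proof.
move=> [a [[p0 q0] [p1 q1]]] [b [[p0' q0'] [p1' q1']]]; apply: val_inj.
rewrite /= /bits2pair /swap_fun /= bit2Z_eq1.
by case: b => /=; rewrite !bit2ZM.
Qed.

Lemma bits2W_inj : injective bits2W.
Proof.
move=> [a [[p0 q0] [p1 q1]]] [b [[p0' q0'] [p1' q1']]] /(congr1 val)[].
by do 5 move=> /bit2Z_inj->.
Qed.

Lemma bits2W_surj x : exists s, x = bits2W s.
Proof.
case: x => [[a [[p0 q0] [p1 q1]]] ax].
have [a' aE] := bit2Z_surj a.
have [[p0' p0E] [q0' q0E]] := (bit2Z_surj p0, bit2Z_surj q0).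
have [[p1' p1E] [q1' q1E]] := (bit2Z_surj p1, bit2Z_surj q1).
exists (a', ((p0', q0'), (p1', q1'))); apply: val_inj.
by rewrite /= /bits2pair /= -aE -p0E -q0E -p1E -q1E.
Qed.

End WreathEncoding.

(** * Galois groups acting by signs on two pairs of square roots *)

Lemma sqr_signP (R : idomainType) (x y : R) :
  x ^+ 2 = y ^+ 2 -> x = (-1) ^+ (x != y) * y.
Proof.
move/eqP; rewrite eqf_sqr; have [->|_ /= /eqP->] := eqVneq x y.
  by rewrite mul1r.
by rewrite expr1 mulN1r.
Qed.

Section SignAction.

Variables (L : splittingFieldType rat) (w v : bool -> L).

Hypothesis permute_sqr : forall g : gal_of {:L}, exists a : bool, forall i,
  g (w i) ^+ 2 = w (i (+) a) ^+ 2 /\ g (v i) ^+ 2 = v (i (+) a) ^+ 2.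
Hypothesis irrational : forall a b c : bool, a || b || c ->
  (w false ^+ 2 - w true ^+ 2) ^+ a * (w false * w true) ^+ b
    * (v false * v true) ^+ c \notin 1%VS.
Hypothesis generated :
  <<1 & [:: w false; w true; v false; v true]>>%VS = {:L}%VS.

Implicit Types (g h : gal_of {:L}) (i j : bool).

Let natL_neq0 n : n.+1%:R != 0 :> L.
Proof. by have /pcharf0P-> := ftrans (pchar_lalg L) (pchar_num _). Qed.

Let signed_neq (b : bool) (x : L) : x != 0 -> ((-1) ^+ b * x != x) = b.
Proof.
move=> x0; case: b; rewrite ?mul1r ?eqxx // expr1 mulN1r eq_sym -subr_eq0.
by rewrite opprK -mulr2n -mulr_natr mulf_neq0.
Qed.

(** A zero would make [w false * w true] vanish, hence rational. The next two facts use the same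
    device. *)
Let w_neq0 i : w i != 0.
Proof.
apply: contraNneq (@irrational false true false isT) => wi.
rewrite !expr0 mulr1 mul1r expr1.
by case: i wi => ->; rewrite ?mulr0 ?mul0r mem0v.
Qed.

Let v_neq0 i : v i != 0.
Proof.
apply: contraNneq (@irrational false false true isT) => vi.
rewrite !expr0 !mul1r expr1.
by case: i vi => ->; rewrite ?mulr0 ?mul0r mem0v.
Qed.

Let w_sqr_neq i : w (~~ i) ^+ 2 != w i ^+ 2.
Proof.
apply: contraNneq (@irrational true false false isT) => wi.
rewrite !expr0 !mulr1 expr1.
by case: i wi => /= ->; rewrite subrr mem0v.
Qed.

(** The two squares differ, so the image of one of them determines the permutation. *)
Definition gal_top g : bool := g (w false) ^+ 2 != w false ^+ 2.

(* Signs are indexed by the target [j] of the permutation, which matches the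
   convention of [sdprod_by]. *)
Definition gal_sign (x : bool -> L) g j : bool := g (x (j (+) gal_top g)) != x j.

Definition gal_bits g : wreath_bits :=
  (gal_top g, ((gal_sign w g false, gal_sign v g false),
               (gal_sign w g true, gal_sign v g true))).

Let gal_sqr g i : g (w i) ^+ 2 = w (i (+) gal_top g) ^+ 2 /\
                  g (v i) ^+ 2 = v (i (+) gal_top g) ^+ 2.
Proof.
have [a ga] := permute_sqr g; suff -> : gal_top g = a by [].
rewrite /gal_top (ga false).1; case: (a); first exact: (w_sqr_neq false).
by rewrite eqxx.
Qed.

Let gal_w g i : g (w i) = (-1) ^+ gal_sign w g (i (+) gal_top g) * w (i (+) gal_top g).
Proof. by rewrite /gal_sign addbK; apply: sqr_signP; rewrite (gal_sqr g i).1. Qed.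

Let gal_v g i : g (v i) = (-1) ^+ gal_sign v g (i (+) gal_top g) * v (i (+) gal_top g).
Proof. by rewrite /gal_sign addbK; apply: sqr_signP; rewrite (gal_sqr g i).2. Qed.

Let gal_topM g h : gal_top (g * h)%g = gal_top g (+) gal_top h.
Proof.
rewrite {1}/gal_top galM ?memvf // -rmorphXn (gal_sqr g false).1 rmorphXn /=.
rewrite (gal_sqr h _).1; case: (_ (+) _); first exact: (w_sqr_neq false).
by rewrite eqxx.
Qed.

(** The product [g * h] applies [g] first, and [h] fixes the resulting sign; the index of that sign
    is then moved by [h]. *)
Let gal_signM (x : bool -> L) : (forall i, x i != 0) ->
    (forall g i, g (x i) = (-1) ^+ gal_sign x g (i (+) gal_top g)
                           * x (i (+) gal_top g)) ->
  forall g h j, gal_sign x (g * h)%g j =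
    gal_sign x g (j (+) gal_top h) (+) gal_sign x h j.
Proof.
move=> x0 gx g h j; rewrite {1}/gal_sign gal_topM galM ?memvf // gx.
rewrite addbA addbAC addbK rmorphM rmorph_sign.
rewrite /= gx addbK mulrA -signr_addb.
exact: signed_neq.
Qed.

Lemma gal_bitsM : {morph gal_bits : g h / (g * h)%g >-> bits_mul g h}.
Proof.
move=> g h; rewrite /gal_bits gal_topM.
rewrite !(gal_signM w_neq0 gal_w) !(gal_signM v_neq0 gal_v) /=.
by case: (gal_top h).
Qed.

(** Equal bits mean equal values on the generators, so [g * h^-1] fixes the whole field. *)
Lemma gal_bits_inj : injective gal_bits.
Proof.
move=> g h gh.
have top_gh : gal_top g = gal_top h by have := congr1 fst gh.
have sign_gh i : gal_sign w g i = gal_sign w h i /\ gal_sign v g i = gal_sign v h i.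
  by case: gh; case: i.
have gh_w i : g (w i) = h (w i) by rewrite !gal_w top_gh (sign_gh _).1.
have gh_v i : g (v i) = h (v i) by rewrite !gal_v top_gh (sign_gh _).2.
have kfix x : g x = h x -> x \in fixedField [set (g * h^-1)%g].
  move=> gx; apply/fixedFieldP; rewrite ?memvf // => _ /set1P->.
  by rewrite galM ?memvf // gx -galM ?memvf // mulgV gal_id.
apply/eqP; rewrite eq_mulgV1; apply/gal_eqP => x _.
have : x \in fixedField [set (g * h^-1)%g].
  apply: subvP (memvf x); rewrite -[X in (X <= _)%VS]generated.
  apply/Fadjoin_seqP; split.
    exact: sub1v.
  by apply/allP; rewrite /= !kfix.
by move/fixedFieldP => ->; rewrite ?memvf ?gal_id ?set11.
Qed.

(** Exchanging the indices negates the difference of squares but preserves both products, which only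
    feel the signs. This ties the three characters to the three square roots. *)
Lemma gal_bits_chi (a b c : bool) g :
  let d := (w false ^+ 2 - w true ^+ 2) ^+ a * (w false * w true) ^+ b
    * (v false * v true) ^+ c in
  g d = (-1) ^+ ((a && chi_top (gal_bits g)) (+) (b && chi_fst (gal_bits g))
                  (+) (c && chi_snd (gal_bits g))) * d.
Proof.
have gal_diff : g (w false ^+ 2 - w true ^+ 2) =
    (-1) ^+ chi_top (gal_bits g) * (w false ^+ 2 - w true ^+ 2).
  rewrite rmorphB !rmorphXn /= !(gal_sqr g _).1 /chi_top /=.
  by case: (gal_top g) => /=; rewrite ?mul1r // expr1 mulN1r opprB.
have gal_prod (x : bool -> L) :
    (forall i, g (x i) = (-1) ^+ gal_sign x g (i (+) gal_top g)
                           * x (i (+) gal_top g)) ->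
  g (x false * x true) =
    (-1) ^+ (gal_sign x g false (+) gal_sign x g true) * (x false * x true).
  move=> gx; rewrite rmorphM /= !gx signr_addb.
  case: (gal_top g) => /=; last by rewrite mulrACA.
  by rewrite mulrACA [X in X * _]mulrC [X in _ * X]mulrC.
rewrite /= !rmorphM !rmorphXn /= gal_diff (gal_prod w (gal_w g)) (gal_prod v (gal_v g)).
rewrite /chi_top /chi_fst /chi_snd /=.
move: (gal_top g) (gal_sign w g _ (+) _) (gal_sign v g _ (+) _) => t x y.
by case: a b c => [] [] []; rewrite /= ?addbF ?signr_addb ?expr1 ?expr0; ring.
Qed.

(** For [bits_full]: an irrational [d] is moved by some automorphism, since the fixed field of the
    Galois group is the base field, and being moved means that the corresponding character is
    nontrivial there. *)
Lemma gal_bits_surj s : exists2 g, g \in 'Gal({:L} / 1)%g & gal_bits g = s.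
Proof.
have galL : galois 1 {:L}.
  rewrite /galois sub1v normalFieldf andbT; apply/separableP=> u _.
  exact/pcharf0_separable/(ftrans (pchar_lalg L) (pchar_num _)).
pose S s := exists2 g, g \in 'Gal({:L} / 1)%g & gal_bits g = s.
apply: (@bits_full S) s => [_ _ [g Gg <-] [h Gh <-] | a b c abc].
  by exists (g * h)%g; rewrite ?groupM ?gal_bitsM.
have chi_notin := irrational abc; set d := (X in X \notin _) in chi_notin.
have [g Gg gd] : exists2 g, g \in 'Gal({:L} / 1)%g & g d != d.
  apply/exists_inP; apply: contraNT chi_notin => /exists_inPn fixd.
  rewrite -(galois_fixedField galL); apply/fixedFieldP; first exact: memvf.
  by move=> g /fixd; rewrite negbK => /eqP.
exists (gal_bits g); first by exists g.
by apply: contraNT gd; rewrite gal_bits_chi => /negbTE->; rewrite mul1r.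
Qed.

Lemma gal_isog_wreath :
  ('Gal({:L} / 1) \isog [set: wreathC2 ('Z_2 * 'Z_2)%type])%g.
Proof.
have phiM : {in 'Gal({:L} / 1)%g &, {morph bits2W \o gal_bits : g h / (g * h)%g}}.
  by move=> g h _ _; rewrite /= gal_bitsM bits2WM.
pose phi := Morphism phiM.
have injphi : ('injm phi)%g.
  by apply/injmP=> g h _ _ /bits2W_inj/gal_bits_inj.
rewrite (_ : [set: _] = (phi @* 'Gal({:L} / 1))%g) ?sub_isog //.
apply/esym/setP=> x; rewrite inE; have [s ->] := bits2W_surj x.
by have [g Gg <-] := gal_bits_surj s; rewrite (mem_morphim phi).
Qed.

End SignAction.

(** * The octic over a field generated by the [w i] and [v i] *)

Section CalF3.

Variables (A : int) (L : fieldExtType rat) (w v : bool -> L).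

Hypothesis v_sqr : forall i, v i ^+ 2 = w i ^+ 2 - 4.
Hypothesis w_sum : w false ^+ 2 + w true ^+ 2 = 4 - A%:~R.
Hypothesis w_prod : (w false * w true) ^+ 2 = 2 - A%:~R.
Hypothesis generated :
  <<1 & [:: w false; w true; v false; v true]>>%VS = {:L}%VS.

Let natL_neq0 n : n.+1%:R != 0 :> L.
Proof. by have /pcharf0P-> := ftrans (pchar_lalg L) (pchar_num _). Qed.

Let a i : L := (w i + v i) / 2.
Let b i : L := (w i - v i) / 2.

(** Since [w i ^+ 2 - v i ^+ 2 = 4], the elements [a i] and [b i] are inverse to each other, and
    their squares sum to [w i ^+ 2 - 2]. *)
Let quartic i :
  ('X - (a i)%:P) * ('X - (- a i)%:P) * ('X - (b i)%:P) * ('X - (- b i)%:P)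
    = 'X^4 - (w i ^+ 2 - 2)%:P * 'X^2 + 1 :> {poly L}.
Proof.
have ab : a i * b i = 1.
  have -> : a i * b i = (w i ^+ 2 - v i ^+ 2) / 4.
    rewrite /a /b; field. by rewrite !natL_neq0.
  by rewrite v_sqr; field; rewrite !natL_neq0.
have -> : w i ^+ 2 - 2 = a i ^+ 2 + b i ^+ 2.
  have -> : a i ^+ 2 + b i ^+ 2 = (w i ^+ 2 + v i ^+ 2) / 2.
    by rewrite /a /b; field; rewrite !natL_neq0.
  by rewrite v_sqr; field; rewrite !natL_neq0.
have -> : 1 = ((a i * b i) ^+ 2)%:P :> {poly L} by rewrite ab expr1n.
by rewrite !rmorphE /=; ring.
Qed.

(** The octic is the product of the two quartics, and its roots generate the field because
    [w i = a i + b i] and [v i = a i - b i]. *)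
Lemma calF3_splitting :
  splittingFieldFor 1%VS
    (map_poly (in_alg L) (map_poly intr (calF3 A A))) {:L}%VS.
Proof.
pose rs i := [:: a i; - a i; b i; - b i].
exists (rs false ++ rs true).
  rewrite big_cat !big_cons !big_nil /= !mulr1 !mulrA quartic.
  rewrite -!mulrA [X in _ * X]mulrA [X in _ * X]mulrA quartic.
  suff -> : map_poly (in_alg L) (map_poly intr (calF3 A A)) =
      ('X^4 - (w false ^+ 2 - 2)%:P * 'X^2 + 1)
      * ('X^4 - (w true ^+ 2 - 2)%:P * 'X^2 + 1) by exact: eqpxx.
  rewrite /calF3 !rmorphD !rmorph1 /= !map_polyZ !map_polyXn /= scaler_int.
  rewrite -!mul_polyC.
  pose s : {poly L} := (w false ^+ 2 + w true ^+ 2)%:P.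
  pose t : {poly L} := ((w false * w true) ^+ 2)%:P.
  (* With [s = 4 - A] and [t = 2 - A] the three middle coefficients all become [A]. *)
  transitivity ('X^8 - (s - 4) * 'X^6 + (t - 2 * s + 6) * 'X^4 - (s - 4) * 'X^2 + 1).
    by rewrite /s /t w_sum w_prod; ring.
  by rewrite /s /t; ring.
apply/eqP; rewrite eqEsubv subvf -[X in (X <= _)%VS]generated.
apply/Fadjoin_seqP; split; first exact: sub1v.
set K := <<1 & _>>%AS.
have memK x : x \in rs false ++ rs true -> x \in K by apply: seqv_sub_adjoin.
have abK i : a i \in K /\ b i \in K.
  by case: i; split; apply: memK; rewrite !inE eqxx ?orbT.
have wvK i : w i \in K /\ v i \in K.
  have [aK bK] := abK i; split.
    by rewrite (_ : w i = a i + b i) ?rpredD // /a /b; field; rewrite !natL_neq0.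
  by rewrite (_ : v i = a i - b i) ?rpredB // /a /b; field; rewrite !natL_neq0.
by apply/allP; rewrite /= !(wvK _).1 !(wvK _).2.
Qed.

Let v_prod : (v false * v true) ^+ 2 = 3 * A%:~R + 2.
Proof.
rewrite exprMn !v_sqr.
transitivity ((w false * w true) ^+ 2 - 4 * (w false ^+ 2 + w true ^+ 2) + 16).
  by ring.
by rewrite w_prod w_sum; ring.
Qed.

Let w_diff : (w false ^+ 2 - w true ^+ 2) ^+ 2 = (A%:~R - 2) ^+ 2 + 4.
Proof.
transitivity ((w false ^+ 2 + w true ^+ 2) ^+ 2 - 4 * (w false * w true) ^+ 2).
  by ring.
by rewrite w_sum w_prod; ring.
Qed.

(** If the element were a rational [r], squaring it would make the integer product a rational
    square. *)
Lemma calF3_irrational (i j k : bool) :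
    (forall r : rat, r ^+ 2 !=
       (((A - 2) ^+ 2 + 4) ^+ i * (2 - A) ^+ j * (3 * A + 2) ^+ k)%:~R) ->
  (w false ^+ 2 - w true ^+ 2) ^+ i * (w false * w true) ^+ j
    * (v false * v true) ^+ k \notin 1%VS.
Proof.
move=> nonsq; apply/vlineP => -[r /(congr1 (fun x => x ^+ 2))].
rewrite 2!exprMn !(exprAC _ _ 2) w_diff w_prod v_prod => rE.
case/eqP: (nonsq r); apply: (fmorph_inj (in_alg L)).
rewrite rmorphXn /= -rE scaler_int 2!intrM !rmorphXn /=.
by congr (_ ^+ i * _ ^+ j * _ ^+ k); ring.
Qed.

Lemma calF3_permute_sqr (g : {rmorphism L -> L}) : exists c : bool, forall i,
  g (w i) ^+ 2 = w (i (+) c) ^+ 2 /\ g (v i) ^+ 2 = v (i (+) c) ^+ 2.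
Proof.
have g_sum : g (w false) ^+ 2 + g (w true) ^+ 2 = w false ^+ 2 + w true ^+ 2.
  by rewrite -!rmorphXn -rmorphD /= w_sum rmorphB /= rmorph_int rmorph_nat.
have g_prod : (g (w false) * g (w true)) ^+ 2 = (w false * w true) ^+ 2.
  by rewrite -rmorphM -rmorphXn /= w_prod rmorphB /= rmorph_int rmorph_nat.
have [c gc] : exists c : bool, g (w false) ^+ 2 = w c ^+ 2.
  (* The automorphism preserves the sum and product of the [w i ^+ 2], so it sends one root of their
     quadratic to a root of the same quadratic. *)
  have : (g (w false) ^+ 2 - w false ^+ 2) * (g (w false) ^+ 2 - w true ^+ 2) = 0.
    transitivity ((g (w false) ^+ 2) ^+ 2 -
        (w false ^+ 2 + w true ^+ 2) * g (w false) ^+ 2 + (w false * w true) ^+ 2).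
      by ring.
    by rewrite -g_sum -g_prod; ring.
  by move/eqP; rewrite mulf_eq0 !subr_eq0 => /orP[]/eqP; [exists false | exists true].
have gw i : g (w i) ^+ 2 = w (i (+) c) ^+ 2.
  case: i => //=; move: g_sum; rewrite gc; case: (c) => /=.
    by rewrite addrC => /addIr.
  by move/addrI.
exists c => i; split; first exact: gw.
by rewrite -rmorphXn v_sqr rmorphB rmorphXn /= gw v_sqr rmorph_nat.
Qed.

End CalF3.

(** * Existence of the field and infinitely many parameters *)

Lemma calF3_generators (A : int) : exists (L : fieldExtType rat) (w v : bool -> L),
  [/\ forall i, v i ^+ 2 = w i ^+ 2 - 4,
      w false ^+ 2 + w true ^+ 2 = 4 - A%:~R,
      (w false * w true) ^+ 2 = 2 - A%:~R &
      <<1 & [:: w false; w true; v false; v true]>>%VS = {:L}%VS].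
Proof.
pose d : algC := sqrtC ((A%:~R - 2) ^+ 2 + 4).
(* These are [z_i + 2], the roots of [y^2 - (4 - A) y + (2 - A)], whose discriminant is
   [(A - 2)^2 + 4]. *)
pose y (i : bool) : algC := (4 - A%:~R + (-1) ^+ i * d) / 2.
pose w i := sqrtC (y i); pose v i := sqrtC (y i - 4).
have [L [f [s fs gen]]] := num_field_exists [:: w false; w true; v false; v true].
case: s fs gen => [|w0 [|w1 [|v0 [|v1 []]]]] // [fw0 fw1 fv0 fv1] gen.
exists L, (fun i => if i then w1 else w0), (fun i => if i then v1 else v0).
have two_neq0 : 2 != 0 :> algC by rewrite pnatr_eq0.
have fw i : f (if i then w1 else w0) ^+ 2 = y i.
  by case: i; rewrite ?fw0 ?fw1 sqrtCK.
have fv i : f (if i then v1 else v0) ^+ 2 = y i - 4.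
  by case: i; rewrite ?fv0 ?fv1 sqrtCK.
split=> [i|||//]; apply: (fmorph_inj f).
- by rewrite rmorphB !rmorphXn /= fw fv rmorph_nat.
- rewrite rmorphD rmorphB !rmorphXn rmorph_nat rmorph_int /=.
  by rewrite (fw false) (fw true) /y; field.
- rewrite rmorphXn rmorphM exprMn rmorphB rmorph_nat rmorph_int /=.
  rewrite (fw false) (fw true) /y.
  transitivity (((4 - A%:~R) ^+ 2 - d ^+ 2) / 4 : algC); first by field.
  by rewrite sqrtCK; field.
Qed.

Lemma calF3_galois (n : nat) (A := (12 * n + 5)%N%:Z) :
  galois_group_isog (map_poly intr (calF3 A A)) (wreathC2 ('Z_2 * 'Z_2)%type).
Proof.
have [L0 [w [v [v_sqr w_sum w_prod gen]]]] := calF3_generators A.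
have splitL := calF3_splitting v_sqr w_sum w_prod gen.
(* [L0] is so far only a field extension; splitting the rational octic makes it a
   [splittingFieldType]. *)
have axL : splitting_field_axiom L0.
  exists (map_poly (in_alg L0) (map_poly intr (calF3 A A))) => //.
  apply/polyOverP => i; rewrite coef_map; exact: memvZ (mem1v _).
pose L : splittingFieldType rat :=
  HB.pack L0 (FieldExt_isSplittingField.Build rat L0 axL).
exists L; first exact: splitL.
apply: (@gal_isog_wreath L w v) => // [g | a b c abc].
  exact: calF3_permute_sqr v_sqr w_sum w_prod _.
by apply: (calF3_irrational v_sqr w_sum w_prod) => r; apply: nonsquare_products.
Qed.

From mathcomp Require Import classical_sets cardinality.

Theorem theorem1p2 :
  infinite_set [set A : int | (A = 1 %[mod 4])%Z /\
    galois_group_isog (map_poly intr (calF3 A A))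
      (wreathC2 ('Z_2 * 'Z_2)%type)]%classic.
Proof.
move=> finS; apply: infinite_nat.
pose f n := (12 * n + 5)%N%:Z.
(* The injective progression [f] lands in the set, so finiteness of the set would pull back to all
   of [nat]. *)
rewrite (_ : [set: nat]%classic = (f @^-1` [set A : int | (A = 1 %[mod 4])%Z /\
    galois_group_isog (map_poly intr (calF3 A A))
      (wreathC2 ('Z_2 * 'Z_2)%type)])%classic).
  by apply: finite_preimage => // m n _ _; rewrite /f; lia.
apply/seteqP; split=> // n _; split; last exact: calF3_galois.
by rewrite /f; lia.
Qed.
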